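(* For every real number $c\geq 1$ and every integer $k\geq 6$, there exists a graph of cliquewidth at most $k$ that is not $c$-quasi-isometric to any graph of treewidth less than $k-3$.
   Context: Graphs are finite and simple. $\mathrm{dist}_G(u,v)$ is the length of a shortest $u$–$v$ path ($\infty$ if none). For real $c>0$, a map $f:V(G)\to V(H)$ is a $c$-quasi-isometry if (QI1) for all $x,y\in V(G)$, $\mathrm{dist}_G(x,y)/c-c\leq \mathrm{dist}_H(f(x),f(y))\leq c\,\mathrm{dist}_G(x,y)+c$, and (QI2) every $z\in V(H)$ has some $v\in V(G)$ with $\mathrm{dist}_H(z,f(v))\leq c$; $G$ is $c$-quasi-isometric to $H$ if such $f$ exists. Cliquewidth: with colourings $c:V(G)\to\{1,\dots,k\}$ (colour $i$ used if $c^{-1}(i)\ne\emptyset$), $(G,c)$ is a cliquewidth-$k$ pair if $|V(G)|\leq 1$ or: (OP1) $G$ is the disjoint union of nonempty $G_1,G_2$ with $(G_1,c|_{V(G_1)}),(G_2,c|_{V(G_2)})$ cliquewidth-$k$ pairs; or (OP2) there are a colouring $c'$ and distinct $i,j$, both used by $c'$, with $(G,c')$ a cliquewidth-$k$ pair and $c$ obtained from $c'$ by recolouring every vertex of colour $i$ to $j$; or (OP3) there are a proper spanning subgraph $G'$ of $G$ and distinct $i,j$ with $(G',c)$ a cliquewidth-$k$ pair and $G$ obtained from $G'$ by adding all edges between vertices coloured $i$ and vertices coloured $j$. The cliquewidth of $G$ is the least $k$ such that $(G,c)$ is a cliquewidth-$k$ pair for some colouring $c$ with colours $\{1,\dots,k\}$.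 Treewidth is the usual minimum width (maximum bag size minus 1) of a tree-decomposition. *)

(* Defs.v *)
From mathcomp Require Import all_boot all_order all_algebra.
From mathcomp Require Import boolp.
From mathcomp Require classical_sets reals ereal.

Set Implicit Arguments.
Unset Strict Implicit.
Unset Printing Implicit Defensive.

Import Order.TTheory GRing.Theory Num.Theory.

Record sgraph (V : finType) := SGraph {
  edge :> rel V;
  edge_sym : symmetric edge;
  edge_irr : irreflexive edge
}.

Section Induced.
Variables (V : finType) (G : sgraph V) (A : {set V}).

Definition induced_rel : rel {x : V | x \in A} := relpre val G.

Lemma induced_sym : symmetric induced_rel.
Proof. by move=> x y; rewrite /induced_rel /= edge_sym. Qed.

Lemma induced_irr : irreflexive induced_rel.
Proof. by move=> x; rewrite /induced_rel /= edge_irr. Qed.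

Definition induced : sgraph {x : V | x \in A} := SGraph induced_sym induced_irr.
End Induced.

Section Cliquewidth.
Local Open Scope nat_scope.

(* The colours 1, ..., k are represented by 'I_k. In cw_union the disjoint union
   is internal: A and its complement are the vertex sets of the two parts. *)
Inductive cw_pair (k : nat) :
    forall V : finType, sgraph V -> (V -> 'I_k) -> Prop :=
| cw_small (V : finType) (G : sgraph V) (c : V -> 'I_k) :
    #|V| <= 1 -> cw_pair G c
| cw_union (V : finType) (G : sgraph V) (c : V -> 'I_k) (A : {set V}) :
    A != set0 -> ~: A != set0 ->
    (forall x y, x \in A -> y \in ~: A -> ~~ G x y) ->
    cw_pair (induced G A) (fun x => c (val x)) ->
    cw_pair (induced G (~: A)) (fun x => c (val x)) ->
    cw_pair G c
| cw_recolour (V : finType) (G : sgraph V) (c c' : V -> 'I_k) (i j : 'I_k) :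
    i != j -> (exists x, c' x = i) -> (exists x, c' x = j) ->
    cw_pair G c' ->
    (forall x, c x = if c' x == i then j else c' x) ->
    cw_pair G c
| cw_join (V : finType) (G G' : sgraph V) (c : V -> 'I_k) (i j : 'I_k) :
    i != j ->
    (forall x y, G' x y -> G x y) -> (exists x y, G x y && ~~ G' x y) ->
    cw_pair G' c ->
    (forall x y, G x y = [|| G' x y, (c x == i) && (c y == j)
                           | (c x == j) && (c y == i)]) ->
    cw_pair G c.

Definition cw_colourable (V : finType) (G : sgraph V) (k : nat) : Prop :=
  exists c : V -> 'I_k, cw_pair G c.

Section DeleteEdge.
Variables (V : finType) (G : sgraph V) (a b : V).

Definition del_rel : rel V := fun x y =>
  G x y && ~~ ((x == a) && (y == b) || (x == b) && (y == a)).

Lemma del_sym : symmetric del_rel.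
Proof.
move=> x y; rewrite /del_rel edge_sym; congr (_ && ~~ _).
by rewrite orbC andbC [X in _ || X]andbC.
Qed.

Lemma del_irr : irreflexive del_rel.
Proof. by move=> x; rewrite /del_rel edge_irr. Qed.

Definition del_edge : sgraph V := SGraph del_sym del_irr.
End DeleteEdge.

Lemma cw_pair_edgeless k n (V : finType) (G : sgraph V) (c : V -> 'I_k) :
  #|V| <= n -> (forall x y, ~~ G x y) -> cw_pair G c.
Proof.
elim: n V G c => [|n IHn] V G c leVn G0; first exact/cw_small/(leq_trans leVn).
have [le1|lt1] := leqP #|V| 1; first exact: cw_small.
have /card_gt0P[x _] : 0 < #|V| by apply: ltnW.
have cC : #|~: [set x]| = #|V|.-1 by rewrite cardsC1.
apply: (@cw_union _ _ _ _ [set x]).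
- by apply/set0Pn; exists x; rewrite inE.
- by rewrite -card_gt0 cC -ltnS prednK // ltnW.
- by move=> y z _ _; apply: G0.
- by apply: cw_small; rewrite card_sig cards1.
- apply: IHn => [|y z]; last exact: G0.
  by rewrite card_sig cC -ltnS prednK // ltnW.
Qed.

Lemma cw_pair_inj k (V : finType) (G : sgraph V) (c : V -> 'I_k) :
  injective c -> cw_pair G c.
Proof.
move=> c_inj; pose E (G : sgraph V) := [set p : V * V | G p.1 p.2].
have [n] := ubnP #|E G|; elim: n G => // n IHn G ltEn.
have [/existsP[[a b] /= Gab]|] := boolP [exists p : V * V, G p.1 p.2]; last first.
  move/existsPn => G0; apply: (@cw_pair_edgeless _ #|V|) => // x y.
  exact: (G0 (x, y)).
have neq_ab : a != b by apply: contraTneq Gab => ->; rewrite edge_irr.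
apply: (@cw_join _ _ _ (del_edge G a b) _ (c a) (c b)).
- by rewrite (inj_eq c_inj).
- by move=> x y /andP[].
- by exists a, b; rewrite Gab /= /del_rel !eqxx /= andbF.
- apply: IHn; rewrite -ltnS; apply: leq_trans ltEn; rewrite ltnS.
  apply/proper_card/properP; split.
    by apply/subsetP=> p; rewrite !inE => /andP[].
  by exists (a, b); rewrite !inE //= /del_rel !eqxx /= andbF.
- move=> x y; rewrite !(inj_eq c_inj) /= /del_rel.
  case E1: ((x == a) && (y == b)) => /=.
    by case/andP: E1 => /eqP-> /eqP->; rewrite Gab orbT.
  case E2: ((x == b) && (y == a)) => /=.
    by case/andP: E2 => /eqP-> /eqP->; rewrite edge_sym Gab orbT.
  by rewrite andbT orbF.
Qed.

Lemma cw_colourable_ex (V : finType) (G : sgraph V) :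
  exists k, `[< cw_colourable G k >].
Proof.
exists #|V|; apply/asboolP; exists (@enum_rank V).
exact/cw_pair_inj/enum_rank_inj.
Qed.

Definition cliquewidth (V : finType) (G : sgraph V) : nat :=
  ex_minn (cw_colourable_ex G).
End Cliquewidth.

Section Treewidth.
Local Open Scope nat_scope.

Definition connected (V : finType) (G : sgraph V) : Prop :=
  forall x y : V, connect G x y.

(* Every duplicate-free closed walk visits at most two vertices. *)
Definition acyclic (V : finType) (G : sgraph V) : Prop :=
  forall s : seq V, ucycle G s -> size s <= 2.

Definition is_tree (N : finType) (T : sgraph N) : Prop :=
  [/\ 0 < #|N|, connected T & acyclic T].

Definition tree_decomposition (V : finType) (G : sgraph V)
    (N : finType) (T : sgraph N) (bag : N -> {set V}) : Prop :=
  [/\ is_tree T,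
      forall v, exists t, v \in bag t,
      forall u v, G u v -> exists t, (u \in bag t) && (v \in bag t)
    & forall v, connected (induced T [set t | v \in bag t])].

Definition has_max_bag_size (V : finType) (G : sgraph V) (n : nat) : Prop :=
  exists (N : finType) (T : sgraph N) (bag : N -> {set V}),
    tree_decomposition G T bag /\ \max_(t : N) #|bag t| = n.

Lemma has_max_bag_size_ex (V : finType) (G : sgraph V) :
  exists n, `[< has_max_bag_size G n >].
Proof.
exists #|V|; apply/asboolP.
have irr : irreflexive (fun _ _ : unit => false) by [].
have sym : symmetric (fun _ _ : unit => false) by [].
exists unit, (SGraph sym irr), (fun=> [set: V]); split; last first.
  by rewrite (big_pred1 tt) ?cardsT //; case.
split.
- split=> [|[] []|s /andP[_ us]]; rewrite ?card_unit ?connect0 //.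
  by rewrite -(card_uniqP us) (leq_trans (max_card _)) // card_unit.
- by move=> v; exists tt; rewrite inE.
- by move=> u v _; exists tt; rewrite !inE.
- move=> v x y; suff -> : x = y by apply: connect0.
  by apply: val_inj; case: (val x); case: (val y).
Qed.

(* Integer-valued: the graph with no vertices has treewidth -1. *)
Definition treewidth (V : finType) (G : sgraph V) : int :=
  ((ex_minn (has_max_bag_size_ex G))%:Z - 1)%R.
End Treewidth.

Section QuasiIsometry.
Import classical_sets reals ereal.
Local Open Scope ring_scope.
Local Open Scope ereal_scope.
Local Open Scope classical_set_scope.

(* If no path joins u to v, this is the infimum of the empty set, i.e. +oo. *)
Definition dist (R : realType) (V : finType) (G : sgraph V) (u v : V) : \bar R :=
  ereal_inf [set ((size p)%:R)%:E |
    p in [set p : seq V | [/\ path G u p, last u p = v & uniq (u :: p)]]].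

Definition quasi_isometry (R : realType) (c : R) (V W : finType)
    (G : sgraph V) (H : sgraph W) (f : V -> W) : Prop :=
  (forall x y : V,
     dist R G x y * c^-1%:E - c%:E <= dist R H (f x) (f y) /\
     dist R H (f x) (f y) <= c%:E * dist R G x y + c%:E) /\
  (forall z : W, exists v : V, dist R H z (f v) <= c%:E).

Definition quasi_isometric (R : realType) (c : R) (V W : finType)
    (G : sgraph V) (H : sgraph W) : Prop :=
  exists f : V -> W, quasi_isometry c G H f.
End QuasiIsometry.

(* Main.v *)
Require Import Defs.
From mathcomp Require Import all_boot all_order all_algebra.
From mathcomp Require Import reals.
From mathcomp Require Import perm boolp.
From mathcomp Require classical_sets constructive_ereal ereal.
From mathcomp Require Import zify.
Set Implicit Arguments.
Unset Strict Implicit.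
Unset Printing Implicit Defensive.
Import Order.TTheory GRing.Theory Num.Theory.

(** With [n = k - 3], take for [G] the complete bipartite graph [K_(n, n+1)]
    whose edges are replaced by paths of a length [L] that is huge compared with
    [c]. The [n+1] stars can be built separately with [n + 3] colours, one for
    each of the [n] sides on which their leaves will be attached and three for
    growing the legs; hence the cliquewidth is at most [k].

    If [f : G -> H] is a quasi-isometry, let [A_i] be a large ball around the
    image of the [i]-th vertex on the side of size [n]. Outside these balls the
    neighbourhoods of the images of different stars are disjoint, and the
    component containing the image of the centre of the [j]-th star is a connected
    set [Z_j] adjacent to every [A_i]. So [H] has a [K_(n, n+1)] minor, and the
    sets [A_i :|: Z_j] with [Z_0] form a bramble of order [n + 1], which forces
    a bag with more than [n] vertices in every tree-decomposition of [H]. *)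

(** * Cliquewidth operations freed of their non-degeneracy conditions *)

Section CliquewidthRules.
Local Open Scope nat_scope.

(** The parts of a union live on subset types, so pairs have to be carried along bijections; [h]
    restricts to the preimages of [A] and of its complement. *)
Lemma cw_pair_iso k (V : finType) (G : sgraph V) (c : V -> 'I_k) :
  cw_pair G c -> forall (V' : finType) (G' : sgraph V') (c' : V' -> 'I_k)
    (h : V' -> V), injective h -> (forall y, exists x, h x = y) ->
  (forall x y, G' x y = G (h x) (h y)) -> (forall x, c' x = c (h x)) ->
  cw_pair G' c'.
Proof.
elim=> {V G c}
  [V G c le1 | V G c A A0 CA0 GA _ IHA _ IHCA
  | V G c c' i j neq_ij [xi ci] [xj cj] _ IH cE
  | V G G' c i j neq_ij sub [a [b Gab]] _ IH GE] V1 G1 c1 h h_inj h_surj G1E c1E.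
- exact/cw_small/(leq_trans _ le1)/(leq_card h).
- have part (B : {set V}) (B1 := [set x | h x \in B]) :
    (forall (V' : finType) (G' : sgraph V') (c' : V' -> 'I_k)
       (h : V' -> {x | x \in B}),
       injective h -> (forall y, exists x, h x = y) ->
       (forall x y, G' x y = induced G B (h x) (h y)) ->
       (forall x, c' x = c (val (h x))) -> cw_pair G' c') ->
    cw_pair (induced G1 B1) (fun x => c1 (val x)).
    move=> IH; have hB (x : {x | x \in B1}) : h (val x) \in B.
      by have := valP x; rewrite inE.
    apply: (IH _ _ _ (fun x => exist _ (h (val x)) (hB x))) => [x y [/h_inj]|||].
    - exact: val_inj.
    - move=> y; have [x hx] := h_surj (val y).
      have xB : x \in B1 by rewrite inE hx; apply: valP.
      by exists (exist _ x xB); apply: val_inj.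
    - by move=> x y; rewrite /= /induced_rel /= G1E.
    - by move=> x; apply: c1E.
  have nonempty (B : {set V}) : B != set0 -> [set x | h x \in B] != set0.
    case/set0Pn=> y yB; have [x hx] := h_surj y.
    by apply/set0Pn; exists x; rewrite inE hx.
  have EC : ~: [set x | h x \in A] = [set x | h x \in ~: A].
    by apply/setP=> x; rewrite !inE.
  apply: (@cw_union _ _ _ _ [set x | h x \in A]); rewrite ?EC.
  + exact: nonempty.
  + exact: nonempty.
  + by move=> x y; rewrite !inE G1E => xA yA; apply: GA; rewrite ?inE.
  + exact: part.
  + exact: part.
- apply: (@cw_recolour _ _ _ _ (c' \o h) i j) => //.
  + by have [x hx] := h_surj xi; exists x; rewrite /= hx.
  + by have [x hx] := h_surj xj; exists x; rewrite /= hx.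
  + exact: (IH _ _ _ h).
  + by move=> x; rewrite c1E cE.
- have sym' : symmetric (relpre h G') by move=> x y /=; rewrite edge_sym.
  have irr' : irreflexive (relpre h G') by move=> x /=; rewrite edge_irr.
  apply: (@cw_join _ _ _ (SGraph sym' irr') _ i j) => //=.
  + by move=> x y; rewrite G1E; apply: sub.
  + have [x hx] := h_surj a; have [y hy] := h_surj b.
    by exists x, y; rewrite G1E hx hy.
  + exact: (IH _ _ _ h).
  + by move=> x y; rewrite G1E GE !c1E.
Qed.

Lemma cw_pair_eq k (V : finType) (G G' : sgraph V) (c c' : V -> 'I_k) :
  cw_pair G c -> G' =2 G -> c' =1 c -> cw_pair G' c'.
Proof.
move=> Gc eqG eqc; apply: (cw_pair_iso Gc (h := id)) => // y.
by exists y.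
Qed.

Lemma cw_pair_inj_colour k (V : finType) (G : sgraph V) (c : V -> 'I_k)
    (s : 'I_k -> 'I_k) :
  injective s -> cw_pair G c -> cw_pair G (s \o c).
Proof.
move=> s_inj Gc; elim: Gc s s_inj => {V G c}
  [V G c le1 | V G c A A0 CA0 GA _ IHA _ IHCA
  | V G c c' i j neq_ij [xi ci] [xj cj] _ IH cE
  | V G G' c i j neq_ij sub ex _ IH GE] s s_inj.
- exact: cw_small.
- by apply: (@cw_union _ _ _ _ A) => //; [apply: IHA | apply: IHCA].
- apply: (@cw_recolour _ _ _ _ (s \o c') (s i) (s j)).
  + by rewrite (inj_eq s_inj).
  + by exists xi; rewrite /= ci.
  + by exists xj; rewrite /= cj.
  + exact: IH.
  + by move=> x; rewrite /= cE (inj_eq s_inj); case: ifP.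
- apply: (@cw_join _ _ _ G' _ (s i) (s j)); rewrite ?(inj_eq s_inj) //.
    exact: IH.
  by move=> x y; rewrite /= !(inj_eq s_inj).
Qed.

Lemma cw_pair_recolour k (V : finType) (G : sgraph V) (c : V -> 'I_k)
    (i j : 'I_k) :
  cw_pair G c -> cw_pair G (fun x => if c x == i then j else c x).
Proof.
move=> Gc; have [->|neq_ij] := eqVneq i j.
  by apply: cw_pair_eq Gc _ _ => // x; case: eqP.
have [/existsP[x /eqP cx]|/existsPn ni] := boolP [exists x, c x == i]; last first.
  by apply: cw_pair_eq Gc _ _ => // x; rewrite (negbTE (ni x)).
have [/existsP[y /eqP cy]|/existsPn nj] := boolP [exists y, c y == j].
  by apply: (cw_recolour neq_ij _ _ Gc) => //; [exists x | exists y].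
apply: cw_pair_eq (cw_pair_inj_colour (@perm_inj _ (tperm i j)) Gc) _ _ => // z.
rewrite /=; case: tpermP => [->|czj|/eqP/negbTE-> //]; first by rewrite eqxx.
by have := nj z; rewrite czj eqxx.
Qed.

(* Colours are natural numbers here, so that colour classes can be compared by
   arithmetic. *)
Definition cw_on k (V : finType) (G : sgraph V) (S : {set V}) (c : V -> nat) :=
  (forall x, x \in S -> c x <= k) /\
  cw_pair (induced G S) (fun x => inord (c (val x)) : 'I_k.+1).

Lemma inord_eq k a b :
  a <= k -> b <= k -> ((inord a : 'I_k.+1) == inord b) = (a == b).
Proof. by move=> ak bk; rewrite -val_eqE /= !inordK. Qed.

Section CwOn.
Variables (k : nat) (V : finType).
Implicit Types (G : sgraph V) (S A B : {set V}) (c : V -> nat).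

Lemma cw_on_eq G G' S c c' :
  cw_on k G S c -> {in S &, G' =2 G} -> {in S, c' =1 c} -> cw_on k G' S c'.
Proof.
move=> [ck Gc] eqG eqc; split=> [x xS|]; first by rewrite eqc //; apply: ck.
apply: cw_pair_eq Gc _ _ => [x y|x].
  by apply: eqG; apply: valP.
by rewrite eqc //; apply: valP.
Qed.

Lemma cw_on0 G c : cw_on k G set0 c.
Proof.
split=> [x|]; first by rewrite inE.
by apply: cw_small; rewrite card_sig cards0.
Qed.

Lemma cw_on1 G v c : c v <= k -> cw_on k G [set v] c.
Proof.
move=> cv; split=> [x /set1P-> //|].
by apply: cw_small; rewrite card_sig cards1.
Qed.

Lemma cw_on_setT G c :
  cw_on k G setT c -> cw_pair G (fun x => inord (c x) : 'I_k.+1).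
Proof.
case=> _ Gc; apply: (cw_pair_iso Gc (h := fun x => exist _ x (in_setT x))) => //.
  by move=> x y [].
by case=> y yT; exists y; apply: val_inj.
Qed.

Lemma cw_on_recolour G S c i j : i <= k -> j <= k ->
  cw_on k G S c -> cw_on k G S (fun x => if c x == i then j else c x).
Proof.
move=> ik jk [ck Gc]; split=> [x xS|]; first by case: ifP => // _; apply: ck.
apply: cw_pair_eq (cw_pair_recolour (inord i) (inord j) Gc) _ _ => // x.
by rewrite inord_eq //; [case: ifP | apply/ck/valP].
Qed.

Lemma cw_on_union G A B c :
  [disjoint A & B] -> {in A & B, forall x y, ~~ G x y} ->
  cw_on k G A c -> cw_on k G B c -> cw_on k G (A :|: B) c.
Proof.
have [->|A0] := eqVneq A set0; first by rewrite set0U.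
have [->|B0] := eqVneq B set0; first by rewrite setU0.
move=> dAB GAB [cA GA] [cB GB]; split=> [x /setUP[]|]; [exact: cA|exact: cB|].
pose U := {x | x \in A :|: B}.
have inB (x : U) : (val x \in B) = (val x \notin A).
  have := valP x; rewrite inE; have [xA _|//] := boolP (val x \in A).
  by apply/negbTE; rewrite (disjointFr dAB).
have nonempty (D : {set V}) : D \subset A :|: B -> D != set0 ->
    [set x : U | val x \in D] != set0.
  move=> /subsetP sD /set0Pn[x xD]; apply/set0Pn.
  by exists (exist _ x (sD x xD)); rewrite inE.
have part (D : {set V}) : D \subset A :|: B ->
    cw_pair (induced G D) (fun x => inord (c (val x)) : 'I_k.+1) ->
    cw_pair (induced (induced G (A :|: B)) [set x : U | val x \in D])
      (fun x => inord (c (val (val x))) : 'I_k.+1).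
  move=> /subsetP sD /cw_pair_iso GD.
  have hD (x : {x : U | x \in [set x : U | val x \in D]}) : val (val x) \in D.
    by have := valP x; rewrite inE.
  apply: (GD _ _ _ (fun x => exist _ (val (val x)) (hD x))) => //.
    by move=> x y [] /val_inj/val_inj.
  move=> y; have yD : exist _ (val y) (sD _ (valP y)) \in [set x : U | val x \in D].
    by rewrite inE; exact: (valP y).
  exists (exist (fun x : U => x \in [set x : U | val x \in D]) _ yD); exact: val_inj.
have EC : ~: [set x : U | val x \in A] = [set x : U | val x \in B].
  by apply/setP=> x; rewrite !inE inB.
apply: (@cw_union _ _ _ _ [set x : U | val x \in A]); rewrite ?EC.
- exact/nonempty/A0/subsetUl.
- exact/nonempty/B0/subsetUr.
- by move=> x y; rewrite !inE; apply: GAB.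
- exact/part/GA/subsetUl.
- exact/part/GB/subsetUr.
Qed.

(** Since [j] is missing on [A] and [i] on [B], joining these colours in the disjoint union of the
    two sides adds only edges between [A] and [B]. *)
Lemma cw_on_join G A B c i j : i <= k -> j <= k -> i != j ->
  [disjoint A & B] -> {in A, forall x, c x != j} -> {in B, forall y, c y != i} ->
  {in A & B, forall x y, G x y = (c x == i) && (c y == j)} ->
  cw_on k G A c -> cw_on k G B c -> cw_on k G (A :|: B) c.
Proof.
move=> ik jk neq_ij dAB cA cB GAB GA GB.
pose E x y := G x y && ((x \in A) == (y \in A)).
have symE : symmetric E by move=> x y; rewrite /E edge_sym eq_sym.
have irrE : irreflexive E by move=> x; rewrite /E edge_irr.
pose G0 := SGraph symE irrE.
have notA y : y \in B -> (y \in A) = false.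
  by move=> yB; rewrite (disjointFl dAB).
have [ck G0c] : cw_on k G0 (A :|: B) c.
  apply: cw_on_union => //.
  - by move=> x y xA yB; rewrite /= /E xA notA // andbF.
  - by apply: cw_on_eq GA _ _ => // x y xA yA; rewrite /= /E xA yA andbT.
  - by apply: cw_on_eq GB _ _ => // x y xB yB; rewrite /= /E !notA // eqxx andbT.
split=> //.
pose U := {x | x \in A :|: B}.
pose I := induced G (A :|: B); pose I0 := induced G0 (A :|: B).
(* The join rule must add an edge; if [G] has none between [A] and [B], then [G0] already agrees
   with [G] here. *)
have [/existsP[x /existsP[y Hxy]]|/existsPn none] :=
  boolP [exists x, exists y, I x y && ~~ I0 x y]; last first.
  apply: cw_pair_eq G0c _ _ => // x y; have /existsPn/(_ y) := none x.
  by rewrite /I /I0 /= /induced_rel /= /E; case: (G _ _) => //=; rewrite negbK.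
apply: (@cw_join _ _ _ I0 _ (inord i) (inord j)) => //.
- by rewrite inord_eq.
- by move=> ? ? /andP[].
- by exists x, y.
- move=> {x y Hxy} x y; rewrite !inord_eq ?ck //; try exact: valP.
  rewrite /I0 /= /induced_rel /= /E.
  case/setUP: (valP x) => /= xAB; case/setUP: (valP y) => /= yAB.
  + rewrite xAB yAB andbT [c (val y) == j]negbTE ?cA //.
    by rewrite [c (val x) == j]negbTE ?cA // andbF !orbF.
  + rewrite xAB notA // andbF GAB // [c (val y) == i]negbTE ?cB //.
    by rewrite andbF orbF.
  + rewrite yAB notA // andbF edge_sym GAB // [c (val x) == i]negbTE ?cB //=.
    by rewrite andbC.
  + rewrite !notA // andbT [c (val y) == i]negbTE ?cB //.
    by rewrite [c (val x) == i]negbTE ?cB // andbF !orbF.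
Qed.

End CwOn.
End CliquewidthRules.

(** * Brambles and bag sizes of tree-decompositions *)

Section Bramble.
Local Open Scope nat_scope.

(* Paths that stay in S, except that the starting point may lie outside. *)
Definition into (V : finType) (G : sgraph V) (S : {set V}) : rel V :=
  fun x y => G x y && (y \in S).

Definition connected_in (V : finType) (G : sgraph V) (S : {set V}) : Prop :=
  {in S &, forall x y, connect (into G S) x y}.

Lemma connect_into_sub (V : finType) (G : sgraph V) (S S' : {set V}) x y :
  S \subset S' -> connect (into G S) x y -> connect (into G S') x y.
Proof.
move=> /subsetP sS; apply: (connect_sub (e := into G S)) => {}x {}y.
by case/andP=> Gxy yS; apply: connect1; rewrite /into Gxy sS.
Qed.

Lemma connected_inU (V : finType) (G : sgraph V) (A B : {set V}) :
  connected_in G A -> connected_in G B ->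
  (exists x y, [/\ x \in A, y \in B & G x y]) -> connected_in G (A :|: B).
Proof.
move=> cA cB [a [b [aA bB Gab]]].
have sA := subsetUl A B; have sB := subsetUr A B.
have ab : connect (into G (A :|: B)) a b.
  by apply: connect1; rewrite /into Gab (subsetP sB).
have ba : connect (into G (A :|: B)) b a.
  by apply: connect1; rewrite /into edge_sym Gab (subsetP sA).
move=> x y /setUP[xA|xB] /setUP[yA|yB].
- exact/(connect_into_sub sA)/cA.
- apply: connect_trans (connect_into_sub sA (cA x a xA aA)) _.
  exact: connect_trans ab (connect_into_sub sB (cB b y bB yB)).
- apply: connect_trans (connect_into_sub sB (cB x b xB bB)) _.
  exact: connect_trans ba (connect_into_sub sA (cA a y aA yA)).
- exact/(connect_into_sub sB)/cB.
Qed.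

Lemma connected_induced (V : finType) (G : sgraph V) (S : {set V}) :
  connected (induced G S) -> connected_in G S.
Proof.
move=> cS x y xS yS.
have /connectP[p] := cS (exist _ x xS) (exist _ y yS).
elim: p x xS => [|[z zS] p IHp] x xS /=; first by move=> _ [->]; apply: connect0.
case/andP=> Gxz pth lst; apply: connect_trans (IHp z zS pth lst).
by apply: connect1; rewrite /into zS andbT.
Qed.

(** A path from [s] to [t] avoiding the edge would close up with it to a cycle on at least three
    vertices. *)
Lemma acyclic_bridge (N : finType) (T : sgraph N) s t :
  acyclic T -> T s t -> ~~ connect (del_edge T s t) s t.
Proof.
move=> acT Tst; apply/negP=> /connectP[p pth lst].
have neq_st : s != t by apply: contraTneq Tst => ->; rewrite edge_irr.
case/shortenP: pth lst => q pth uq _ lst.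
have /acT : ucycle T (s :: q).
  rewrite /ucycle uq andbT /cycle rcons_path -lst edge_sym Tst andbT.
  by apply: sub_path pth => x y /andP[].
case: q pth lst {uq} => [|x [|y q]] //=; first by move=> _ /eqP; rewrite eq_sym (negbTE neq_st).
by move=> + tx; rewrite -tx /del_rel !eqxx andbF.
Qed.

Lemma iter_cycle (N : finType) (f : N -> N) (x0 : N) :
  exists2 s, s != [::] & ucycle (frel f) s.
Proof.
have /trajectP[i lt_i E] := looping_order f x0.
pose y := iter i f x0; exists (orbit f y).
  by rewrite -size_eq0 size_orbit -lt0n order_gt0.
rewrite /ucycle orbit_uniq andbT -fconnect_f.
suff {2}<- : iter (order f x0 - i).-1 f (f y) = y by apply: fconnect_iter.
by rewrite -iterSr prednK ?subn_gt0 // /y -iterD subnK 1?ltnW // E.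
Qed.

(* If no bag meets all the sets, move each node towards a set missed by its bag:
   in a tree this must at some point traverse an edge back and forth, but the two
   sets missed there lie on different sides of that edge. *)
Lemma bramble_bag (V : finType) (G : sgraph V) (N : finType) (T : sgraph N)
    (bag : N -> {set V}) (I : finType) (F : I -> {set V}) :
  tree_decomposition G T bag ->
  (forall i, F i != set0) -> (forall i, connected_in G (F i)) ->
  (forall i j, exists x y, [/\ x \in F i, y \in F j & (x == y) || G x y]) ->
  exists t, forall i, exists2 v, v \in F i & v \in bag t.
Proof.
move=> [[N0 cT acT] covV covE cbag] F0 cF touch.
pose TF i := [set t | [exists v in F i, v \in bag t]].
have TFP i t : reflect (exists2 v, v \in F i & v \in bag t) (t \in TF i).
  by rewrite inE; apply: exists_inP.
(* A walk in [F i] is followed edge by edge: the nodes holding one vertex are connected, and those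
   of two adjacent vertices share a node. *)
have cTF i : connected_in T (TF i).
  move=> s t /TFP[u uF us] /TFP[v vF vt].
  have /connectP[p] := cF i u v uF vF.
  have bag_in w : w \in F i -> [set t | w \in bag t] \subset TF i.
    by move=> wF; apply/subsetP=> r; rewrite inE => wr; apply/TFP; exists w.
  elim: p u uF s us => [|w p IHp] u uF s us /=.
    move=> _ vu; move: vt; rewrite vu => ut.
    apply: (connect_into_sub (bag_in _ uF)).
    by apply: (connected_induced (cbag u)); rewrite inE.
  case/andP=> /andP[Guw wF] pth lst; have [r /andP[ur wr]] := covE _ _ Guw.
  apply: connect_trans (IHp w wF r wr pth lst).
  apply: (connect_into_sub (bag_in _ uF)).
  by apply: (connected_induced (cbag u)); rewrite inE.
have meetTF i j : exists t, (t \in TF i) && (t \in TF j).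
  have [x [y [xF yF /orP[/eqP xy|Gxy]]]] := touch i j.
    have [t xt] := covV x; exists t; apply/andP.
    by split; apply/TFP; exists x => //; rewrite xy.
  have [t /andP[xt yt]] := covE _ _ Gxy.
  by exists t; apply/andP; split; apply/TFP; [exists x|exists y].
apply: contrapT => none.
have miss t : exists i, t \notin TF i.
  apply: contrapT => nomiss; apply: none; exists t => i; apply/TFP.
  by apply: contrapT => /negP tF; apply: nomiss; exists i.
(* [r] follows [t] on a path towards [TF i]. As [TF i] is connected and misses [t], all of it can be
   reached from [r] without returning to [t]. *)
have step t : exists r, exists i, [/\ t \notin TF i, T t r
   & forall s, s \in TF i -> connect (into T [set~ t]) r s].
  have [i ti] := miss t.
  have [s /andP[sF _]] := meetTF i i.
  have /connectP[p pth lst] := cT t s.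
  case/shortenP: pth lst => [[|r q] /=].
    by move=> _ _ _ st; move: ti; rewrite -st sF.
  case/andP=> Ttr pth /andP[tq _] _ lst; exists r, i; split=> // s' s'F.
  apply: (connect_trans (y := s)).
    apply/connectP; exists q => //.
    elim: q r pth tq {lst Ttr} => //= r' q IHq r /andP[Tr pth].
    rewrite !inE !negb_or => /and3P[tr tr' tq].
    rewrite /into Tr !inE eq_sym tr' /= IHq // inE negb_or tr' //.
  apply: connect_into_sub (cTF i s s' sF s'F).
  by apply/subsetP=> u uF; rewrite !inE; apply: contraNneq ti => <-.
have [nxt nxtP] := choice step.
have /card_gt0P[t0 _] := N0.
have [s s0 /andP[cs us]] := iter_cycle nxt t0.
have Tnxt t : T t (nxt t) by have [i []] := nxtP t.
have le2 : size s <= 2.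
  by apply: acT; rewrite /ucycle us andbT; apply: sub_cycle cs => x y /= /eqP <-.
(* No node is adjacent to itself, so a cycle of [nxt] of length at most two exchanges two nodes. *)
have [t tK] : exists t, nxt (nxt t) = t.
  case: s cs us le2 s0 => [|t [|r [|]]] //=.
    by rewrite andbT => /eqP tt; have := Tnxt t; rewrite tt edge_irr.
  by case/and3P=> /eqP tr /eqP rt _ _ _; exists t; rewrite tr.
have [i [ti Ttr reach_r]] := nxtP t.
have [j [rj _ reach_t]] := nxtP (nxt t); rewrite tK in reach_t.
(* A common node of [TF i] and [TF j] is reached from [nxt t] avoiding [t] and from [t] avoiding
   [nxt t], so it links both without the edge between them. *)
have [x /andP[/reach_r rx /reach_t tx]] := meetTF i j.
have /negP[] := acyclic_bridge acT Ttr.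
have neq_tr : t != nxt t by apply: contraTneq Ttr => <-; rewrite edge_irr.
have avoid u v w : u != w -> connect (into T [set~ w]) u v ->
    forall a b, w \in [:: a; b] -> connect (del_edge T a b) u v.
  move=> uw /connectP[p pth ->] a b wab.
  apply/connectP; exists p => //.
  elim: p u uw pth => //= v' p IHp u uw /andP[/andP[Tuv]]; rewrite !inE => v'w pth.
  rewrite IHp // andbT /del_rel Tuv /=.
  by move: wab uw v'w; rewrite !inE => /orP[]/eqP-> /negbTE-> /negbTE->; rewrite ?andbF.
apply: (connect_trans (y := x)).
  by apply: avoid tx _ _ _ => //; rewrite !inE eqxx orbT.
rewrite (sym_connect_sym (edge_sym (del_edge T t (nxt t)))).
by apply: avoid rx _ _ _; rewrite ?inE ?eqxx // eq_sym.
Qed.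

Lemma leq_card_transversal (V I : finType) (F : I -> {set V}) (X : {set V}) :
  (forall i j, i != j -> [disjoint F i & F j]) ->
  (forall i, exists2 v, v \in F i & v \in X) -> #|I| <= #|X|.
Proof.
move=> dF hit.
have [g gP] := choice (fun i => let: ex_intro2 v vF vX := hit i in
   ex_intro (fun v => v \in F i /\ v \in X) v (conj vF vX)).
have g_inj : injective g.
  move=> i j gij; apply: contrapT => /eqP/dF/disjointFr/(_ (gP i).1).
  by rewrite gij (gP j).1.
rewrite -(card_codom g_inj); apply/subset_leq_card/subsetP => v /codomP[i ->].
exact: (gP i).2.
Qed.

(* The bramble consists of Z ord0 and all the sets A i :|: Z j. *)
Lemma bipartite_minor_bag n (V : finType) (G : sgraph V)
    (A : 'I_n -> {set V}) (Z : 'I_n.+1 -> {set V}) :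
  (forall i, connected_in G (A i)) -> (forall j, connected_in G (Z j)) ->
  (forall i i', i != i' -> [disjoint A i & A i']) ->
  (forall j j', j != j' -> [disjoint Z j & Z j']) ->
  (forall i j, [disjoint A i & Z j]) ->
  (forall j, Z j != set0) ->
  (forall i j, exists x y, [/\ x \in A i, y \in Z j & G x y]) ->
  forall (N : finType) (T : sgraph N) (bag : N -> {set V}),
  tree_decomposition G T bag -> exists t, n < #|bag t|.
Proof.
move=> cA cZ dA dZ dAZ Z0 adj N T bag dec.
pose F (o : option ('I_n * 'I_n.+1)) :=
  if o is Some (i, j) then A i :|: Z j else Z ord0.
have self j : exists x y, [/\ x \in Z j, y \in Z j & (x == y) || G x y].
  by have /set0Pn[x xZ] := Z0 j; exists x, x; rewrite eqxx.
have [t hit] : exists t, forall o, exists2 v, v \in F o & v \in bag t.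
  apply: (bramble_bag dec).
  - case=> [[i j]|]; last exact: Z0.
    have /set0Pn[x xZ] := Z0 j.
    by apply/set0Pn; exists x; rewrite inE xZ orbT.
  - case=> [[i j]|]; last exact: cZ.
    exact: connected_inU.
  - move=> [[i j]|] [[i' j']|] /=; last exact: self.
    + have [x [y [xA yZ Gxy]]] := adj i j'.
      by exists x, y; rewrite Gxy !inE xA yZ !orbT.
    + have [x [y [xA yZ Gxy]]] := adj i ord0.
      by exists x, y; rewrite Gxy !inE xA yZ !orbT.
    + have [x [y [xA yZ Gxy]]] := adj i' ord0.
      by exists y, x; rewrite edge_sym Gxy !inE xA yZ !orbT.
exists t.
(* If the bag meets every [A i], these and [Z ord0] are [n.+1] disjoint sets that it meets. If it
   misses some [A i], it meets every [Z j], because of the sets [A i :|: Z j]. *)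
have [/forallP hitA|] := boolP [forall i, [exists v in A i, v \in bag t]].
  rewrite -[n in n < _]card_ord -card_option.
  apply: (leq_card_transversal (F := fun o => if o is Some i then A i else Z ord0)).
    move=> [i|] [i'|] // neq; first exact: dA.
    by rewrite disjoint_sym.
  by case=> [i|]; [apply/exists_inP/hitA | apply: (hit None)].
rewrite negb_forall => /existsP[i /exists_inPn missA].
rewrite -[n.+1]card_ord; apply: (leq_card_transversal dZ) => j.
have [v /setUP[vA|vZ] vt] := hit (Some (i, j)); last by exists v.
by have := missA v vA; rewrite vt.
Qed.
End Bramble.

(** * Walks of bounded length, balls and components *)

Section Within.
Local Open Scope nat_scope.
Variables (V : finType) (G : sgraph V).
Implicit Types (S : {set V}).

(** Bounded walks replace distances: they concatenate without being shortened to paths, and no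
    infinite value occurs. *)
Definition reach n (u v : V) : Prop :=
  exists p, [/\ path G u p, last u p = v & size p <= n].

Lemma reach0 u : reach 0 u u.
Proof. by exists [::]. Qed.

Lemma reach1 u v : G u v -> reach 1 u v.
Proof. by move=> Guv; exists [:: v]; rewrite /= Guv. Qed.

Lemma reach_leq m n u v : m <= n -> reach m u v -> reach n u v.
Proof. by move=> mn [p [pth lst szp]]; exists p; split=> //; apply: leq_trans mn. Qed.

Lemma reach_trans m n v u w :
  reach m u v -> reach n v w -> reach (m + n) u w.
Proof.
move=> [p [pth lst szp]] [q [qth qlst szq]]; exists (p ++ q).
by rewrite cat_path last_cat lst pth qth size_cat leq_add.
Qed.

Lemma reach_sym n u v : reach n u v -> reach n v u.
Proof.
case=> p [+ + szp]; elim: p n szp u => [|w p IHp] n /= szp u.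
  by move=> _ ->; apply: reach_leq (reach0 v).
case: n szp => // n szp /andP[Guw pth] lst.
rewrite -addn1; apply: (@reach_trans _ _ w); first exact: IHp lst.
by apply: reach1; rewrite edge_sym.
Qed.

Definition ball n (u : V) : {set V} := [set v | `[< reach n u v >]].

Lemma ballP n u v : reflect (reach n u v) (v \in ball n u).
Proof. by rewrite inE; apply: asboolP. Qed.

(** [into] constrains only the target of each step and need not be symmetric; still, a walk that
    starts in [S] can be reversed. *)
Lemma connected_in_hub S z : z \in S ->
  {in S, forall x, connect (into G S) z x} -> connected_in G S.
Proof.
move=> zS cz x y xS yS; apply: connect_trans (cz y yS).
have /connectP[p] := cz x xS; elim: p z zS {cz} => [|w p IHp] z zS /=.
  by move=> _ ->; apply: connect0.
case/andP=> /andP[Gzw wS] pth lst; apply: connect_trans (IHp w wS pth lst) _.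
by apply: connect1; rewrite /into edge_sym Gzw.
Qed.

Lemma connected_in_ball n u : connected_in G (ball n u).
Proof.
have uB : u \in ball n u by apply/ballP/reach_leq/reach0.
apply: (connected_in_hub uB) => v /ballP[p [pth <- szp]] {v}.
elim/last_ind: p pth szp => [|p x IHp]; first by rewrite connect0.
rewrite rcons_path last_rcons size_rcons => /andP[pth Gx] szp.
apply: connect_trans (IHp pth (ltnW szp)) (connect1 _).
rewrite /into Gx; apply/ballP; exists (rcons p x).
by rewrite rcons_path pth Gx last_rcons size_rcons.
Qed.

Definition component S z : {set V} := [set x | connect (into G S) z x].

Lemma component_sub S z : z \in S -> component S z \subset S.
Proof.
move=> zS; apply/subsetP=> x; rewrite inE => /connectP[p].
elim: p z zS => [|w p IHp] z zS /=; first by move=> _ ->.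
by case/andP=> /andP[_ wS]; apply: IHp.
Qed.

Lemma component_hub S z : z \in component S z.
Proof. by rewrite inE connect0. Qed.

Lemma component_step S z x y :
  x \in component S z -> G x y -> y \in S -> y \in component S z.
Proof.
rewrite !inE => zx Gxy yS; apply: connect_trans zx (connect1 _).
by rewrite /into Gxy.
Qed.

Lemma connected_in_component S z : connected_in G (component S z).
Proof.
apply: (connected_in_hub (component_hub S z)) => x.
rewrite inE => /connectP[p pth ->].
elim/last_ind: p pth => [|p y IHp]; first by rewrite connect0.
rewrite rcons_path last_rcons => /andP[pth Iy].
apply: connect_trans (IHp pth) (connect1 _); have /andP[Gy yS] := Iy.
rewrite /into Gy inE; apply: connect_trans (connect1 Iy).
by apply/connectP; exists p.
Qed.

End Within.

(** * Quasi-isometries in terms of bounded walks *)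

Section Distance.
Local Open Scope ring_scope.
Variables (R : realType).
Import classical_sets constructive_ereal ereal.

Lemma reach_dist (V : finType) (G : sgraph V) n u v :
  reach G n u v -> (dist R G u v <= n%:R%:E)%E.
Proof.
case=> p [pth lst szp]; case/shortenP: pth lst => q pth uq sub lst.
apply: (@le_trans _ _ (size q)%:R%:E).
  by apply: ereal_inf_lbound; exists q => //; split.
rewrite lee_fin ler_nat (leq_trans _ szp) //.
by move: sub; move/uniq_leq_size; apply; case/andP: uq.
Qed.

(** A finite bound excludes the empty infimum [+oo]; the least length of a walk is then a lower
    bound for the lengths of all paths. *)
Lemma dist_reach (V : finType) (G : sgraph V) u v x :
  (dist R G u v <= x%:E)%E -> exists2 n, reach G n u v & n%:R <= x.
Proof.
move=> dx.
have [ex|none] := pselect (exists n, `[< reach G n u v >]); last first.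
  move: dx; suff -> : dist R G u v = +oo%E by rewrite leye_eq.
  rewrite /dist; set S := (X in ereal_inf X).
  suff -> : S = set0 by rewrite ereal_inf0.
  rewrite -subset0 => y [p [pth lst _] _]; apply: none.
  by exists (size p); apply/asboolP; exists p.
exists (ex_minn ex); case: ex_minnP => m /asboolP // _ min.
rewrite -lee_fin; apply: le_trans dx; apply/ereal_infP => _ [p [pth lst _] <-].
by rewrite lee_fin ler_nat; apply: min; apply/asboolP; exists p.
Qed.

Section QI.
Variables (c : R) (C : nat) (V W : finType) (G : sgraph V) (H : sgraph W).
Variable f : V -> W.
Hypotheses (c1 : 1 <= c) (cC : c <= C%:R) (qi : quasi_isometry c G H f).

Lemma qi_reach n x y :
  reach G n x y -> reach H (C * n + C)%N (f x) (f y).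
Proof.
move=> wn; have [_ le_f] := qi.1 x y.
have c0 : 0 <= c by apply: le_trans c1.
have /dist_reach[m wm] : (dist R H (f x) (f y) <= (c * n%:R + c)%:E)%E.
  apply: le_trans le_f _; rewrite EFinD EFinM.
  by rewrite leeD2r // lee_pmul2l ?reach_dist // lte_fin (lt_le_trans _ c1).
move=> le_m; apply: reach_leq wm; rewrite -(ler_nat R) natrD natrM.
by apply: le_trans le_m _; rewrite lerD // ler_wpM2r.
Qed.

(** The lower bound in (QI1) gives distance at most [c * (m + c)] in [G]; an infinite distance there
    would make it infinite too. *)
Lemma qi_reach_inv m x y :
  reach H m (f x) (f y) -> reach G (C * (m + C))%N x y.
Proof.
move=> wm; have [le_f _] := qi.1 x y.
have c0 : 0 < c by apply: lt_le_trans c1.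
have /dist_reach[n wn] : (dist R G x y <= (c * (m%:R + c))%:E)%E.
  have := le_trans le_f (reach_dist wm); rewrite leeBlDr //.
  case: (dist R G x y) => [r| |]; last by rewrite leNye.
    by rewrite -EFinM -EFinD !lee_fin ler_pdivrMr // mulrC.
  by rewrite gt0_mulye ?lte_fin ?invr_gt0 // -EFinD leye_eq.
move=> le_n; apply: reach_leq wn; rewrite -(ler_nat R) natrM natrD.
by apply: le_trans le_n _; rewrite ler_pM ?lerD2l // ?addr_ge0 // ltW.
Qed.
End QI.
End Distance.

(** * The long bipartite graph and its distances *)

Section LongBipartite.
Local Open Scope nat_scope.
Variables (n L : nat).

(* A complete bipartite graph between the vertices [a_i] and the stars
   [j : 'I_n.+1], with long edges: [(i, None)] is [a_i], and
   [(i, Some (j, t))] for [t = 0, ..., L] is the leg joining it to star [j];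
   the ends [t = L] of the legs of a star form a clique, its centre. *)
Definition vtx : finType := ('I_n * option ('I_n.+1 * 'I_L.+1))%type.

Definition leg_rel (x y : vtx) : bool :=
  match x.2, y.2 with
  | None, None => false
  | None, Some (_, t) | Some (_, t), None => (x.1 == y.1) && (t == 0 :> nat)
  | Some (j, t), Some (j', t') => (j == j') &&
      if x.1 == y.1 then (t.+1 == t') || (t'.+1 == t)
      else (t == L :> nat) && (t' == L :> nat)
  end.

Lemma leg_sym : symmetric leg_rel.
Proof.
move=> [i [[j t]|]] [i' [[j' t']|]]; rewrite /leg_rel /= 1?(eq_sym i) //.
by rewrite eq_sym orbC andbC [(_ == L) && _]andbC [RHS]andbC.
Qed.

Lemma leg_irr : irreflexive leg_rel.
Proof.
move=> [i [[j t]|]] //; rewrite /leg_rel /= !eqxx /= orbb.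
by apply/negbTE; rewrite neq_ltn ltnSn orbT.
Qed.

Definition long_bipartite : sgraph vtx := SGraph leg_sym leg_irr.
Local Notation G := long_bipartite.

Definition apex (i : 'I_n) : vtx := (i, None).

(* The distance from [apex i], capped at [L.+1]. *)
Definition apex_dist (i : 'I_n) (v : vtx) : nat :=
  if v.1 != i then L.+1 else if v.2 is Some (_, t) then t.+1 else 0.

(** [apex_dist i] grows by at most one along each edge. *)
Lemma reach_apex_dist m i v : reach G m (apex i) v -> apex_dist i v <= m.
Proof.
move=> [p [pth lst szp]].
suff : apex_dist i v <= apex_dist i (apex i) + size p.
  by rewrite {2}/apex_dist /= eqxx; move/leq_trans; apply.
elim: p (apex i) pth lst {szp} => [|y p IHp] x /=; first by move=> _ ->; rewrite addn0.
case/andP=> Gxy pth lst; apply: leq_trans (IHp _ pth lst) _.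
rewrite addnS -addSn leq_add2r.
case: x y Gxy {pth lst} => [i1 [[j t]|]] [i2 [[j' t']|]] //=;
  rewrite /leg_rel /apex_dist /=.
- case/andP=> _; have := ltn_ord t; have := ltn_ord t'.
  case: (eqVneq i1 i2) => [->|_]; case: (i2 == i) => /=; try case: (i1 == i) => /=; lia.
- by case/andP=> /eqP-> _; case: eqP.
- by case/andP=> /eqP-> /eqP->; case: eqP.
Qed.

(** Edges between vertices other than apices keep the star index, so a walk that changes star passes
    through an apex. *)
Lemma reach_star_apex m i j t i' j' t' : j != j' ->
  reach G m (i, Some (j, t)) (i', Some (j', t')) ->
  exists a, reach G m (i, Some (j, t)) (apex a).
Proof.
move=> neq_j [p [+ + +]].
elim: p m i t => [|[i2 [[j2 t2]|]] p IHp] [|m] i t //=;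
  try by move=> _ [_ jj]; rewrite jj eqxx in neq_j.
  case/andP=> Gxy pth lst szp; have /andP[/eqP jj _] := Gxy; subst j2.
  have [a wa] := IHp m i2 t2 pth lst szp; exists a.
  exact: (@reach_trans _ G 1 m _ _ _ (reach1 (G := G) Gxy) wa).
case/andP=> Gxy _ _ _; exists i2; apply: (@reach_leq _ G 1) => //.
exact: (reach1 (G := G) Gxy).
Qed.

(** * A bipartite minor in every graph quasi-isometric to it *)

Section CoarseMinor.
Variables (C : nat) (W : finType) (H : sgraph W) (f : vtx -> W).
Hypotheses (n0 : 0 < n)
  (f_up : forall m x y, reach G m x y -> reach H (C * m + C) (f x) (f y))
  (f_down : forall m x y, reach H m (f x) (f y) -> reach G (C * (m + C)) x y).

Let i0 : 'I_n := Ordinal n0.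
Let centre j : vtx := (i0, Some (j, ord_max)).
(** An edge is sent to two vertices joined by a walk of length at most [C * 1 + C]. *)
Let r := 2 * C.
(** If [w] is within [r] of the images of two different stars, an apex lies within [C * (2 * r + C)]
    of a star vertex, and its image is within [R] of [w]. *)
Let R := r + (C * (C * (2 * r + C)) + C).
(** Vertices with images at most [2 * R] apart are then within [L] of each other, whereas distinct
    apices are not. *)
Hypothesis large_L : C * (2 * R + C) <= L.

Let A i := ball H R (f (apex i)).
Let near j : {set W} := \bigcup_(p : 'I_n * 'I_L.+1) ball H r (f (p.1, Some (j, p.2))).
Let S j := near j :\: \bigcup_i A i.
Let Z j := component H (S j) (f (centre j)).

Lemma f_edge x y : G x y -> reach H r (f x) (f y).
Proof. by move/reach1/f_up; rewrite muln1 addnn -mul2n. Qed.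

Lemma apex_ball_far m i x : m <= 2 * R -> reach H m (f (apex i)) (f x) ->
  apex_dist i x <= L.
Proof.
move=> mR /f_down/reach_apex_dist/leq_trans; apply; apply: leq_trans large_L.
by rewrite leq_mul2l leq_add2r mR orbT.
Qed.

Lemma A_far i x w : w \in A i -> reach H r (f x) w -> apex_dist i x <= L.
Proof.
move=> /ballP wA /reach_sym wx.
by apply: apex_ball_far (reach_trans wA wx); rewrite /R; lia.
Qed.

Lemma A_disjoint i i' : i != i' -> [disjoint A i & A i'].
Proof.
move=> neq_i; apply/pred0P=> w /=; apply/negP=> /andP[/ballP wi /ballP wi'].
have := apex_ball_far _ (reach_trans wi (reach_sym wi')).
by rewrite /apex_dist /= eq_sym neq_i addnn mul2n ltnn => /(_ (leqnn _)).
Qed.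

Lemma centre_in_S j : f (centre j) \in S j.
Proof.
rewrite inE; apply/andP; split; last first.
  by apply/bigcupP; exists (i0, ord_max) => //; apply/ballP/reach_leq/reach0.
apply/bigcupP=> -[i _] /A_far/(_ (reach_leq (leq0n r) (reach0 H _))).
by rewrite /apex_dist /=; case: eqP => /=; rewrite ltnn.
Qed.

Lemma Z_sub j : Z j \subset S j.
Proof. exact/component_sub/centre_in_S. Qed.

Lemma AZ_disjoint i j : [disjoint A i & Z j].
Proof.
rewrite disjoint_sym disjoints_subset; apply: subset_trans (Z_sub j) _.
apply/subsetP=> w /setDP[_ /bigcupP wA]; rewrite inE.
by apply/negP=> wi; apply: wA; exists i.
Qed.

(** By the choice of [R], a common vertex of [near j] and [near j'] lies in some ball [A a], and
    these balls are removed from [S j]. *)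
Lemma Z_disjoint j j' : j != j' -> [disjoint Z j & Z j'].
Proof.
move=> neq_j; apply: disjointWl (Z_sub j) _; apply: disjointWr (Z_sub j') _.
apply/pred0P=> w /=; apply/negP=> /andP[/setDP[/bigcupP[[i t] _ /ballP wi] /bigcupP wA]].
case/setDP=> /bigcupP[[i' t'] _ /ballP /reach_sym wi'] _.
have /(reach_star_apex neq_j)[a wa] := f_down (reach_trans wi wi').
apply: wA; exists a => //; apply/ballP/reach_sym.
rewrite /R; apply: reach_trans (reach_sym wi) _.
by rewrite addnn -mul2n in wa; apply: f_up.
Qed.

(** Otherwise the image of leg [i] of star [j], followed from the centre, never leaves [Z j]; but
    the last vertex of the leg is next to [apex i], so its image is in [A i]. *)
Lemma AZ_adjacent i j : exists x y, [/\ x \in A i, y \in Z j & H x y].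
Proof.
apply: contrapT => none.
(* The walk from [f u] to [f v] stays within [r] of [f u], hence in [near j]. It avoids [A a] for
   [a != i] because [u] is far from [apex a], and [A i] by [none]. *)
have grow u v : G u v -> (forall a, a != i -> L < apex_dist a u) ->
    (exists p, u = (p.1, Some (j, p.2))) -> f u \in Z j -> f v \in Z j.
  move=> Guv far_u [[iu tu] Eu] uZ; have [p [pth <- szp]] := f_edge Guv.
  elim/last_ind: p pth szp => // p w IHp.
  rewrite rcons_path last_rcons size_rcons => /andP[pth Hw] szp.
  have wr : reach H r (f u) w.
    by exists (rcons p w); rewrite rcons_path pth Hw last_rcons size_rcons.
  have pZ := IHp pth (ltnW szp).
  apply: (component_step pZ Hw); apply/setDP; split.
    by apply/bigcupP; exists (iu, tu) => //=; move: wr; rewrite Eu => /ballP.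
  apply/bigcupP=> -[a _ wA].
  have [ai|/far_u] := eqVneq a i; last by rewrite ltnNge (A_far wA wr).
  by apply: none; exists w, (last (f u) p); rewrite -ai edge_sym.
(* [s] counts steps down from the end [t = L], which is the chosen centre or one clique edge away
   from it. *)
have legZ s (sL : s <= L) : f (i, Some (j, inord (L - s))) \in Z j.
  elim: s sL => [_|s IHs sL].
    rewrite subn0; have -> : (inord L : 'I_L.+1) = ord_max by apply: val_inj; rewrite /= inordK.
    have [->|neq_i] := eqVneq i i0; first exact: component_hub.
    apply: (grow (centre j)); [| |by exists (i0, ord_max)|exact: component_hub].
      by rewrite /= /leg_rel /= eqxx eq_sym (negbTE neq_i) /= eqxx.
    by move=> a _; rewrite /apex_dist /=; case: eqP.
  have tE : (inord (L - s) : 'I_L.+1) = L - s :> nat by rewrite inordK // ltnS leq_subr.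
  apply: (grow (i, Some (j, inord (L - s)))); last exact/IHs/ltnW.
  - rewrite /= /leg_rel /= !eqxx /= tE inordK ?ltnS ?leq_subr //.
    by rewrite subnSK // eqxx orbT.
  - by move=> a; rewrite /apex_dist /= eq_sym => ->.
  - by exists (i, inord (L - s)).
have /(subsetP (Z_sub j))/setDP[_ /bigcupP] := legZ L (leqnn L); apply.
exists i => //; apply/ballP; apply: (@reach_leq _ _ r); first exact: leq_addr.
apply: f_edge; rewrite /= /leg_rel /= eqxx inordK ?subnn //.
Qed.

Lemma coarse_minor_bag (N : finType) (T : sgraph N) (bag : N -> {set W}) :
  tree_decomposition H T bag -> exists t, n < #|bag t|.
Proof.
apply: (bipartite_minor_bag (A := A) (Z := Z)).
- by move=> i; apply: connected_in_ball.
- by move=> j; apply: connected_in_component.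
- exact: A_disjoint.
- exact: Z_disjoint.
- exact: AZ_disjoint.
- by move=> j; apply/set0Pn; exists (f (centre j)); apply: component_hub.
- exact: AZ_adjacent.
Qed.

End CoarseMinor.
End LongBipartite.

(** * Building the long bipartite graph with [n + 3] colours *)

Section LongBipartiteCw.
Local Open Scope nat_scope.
Variables (n L : nat).
Hypothesis L0 : 0 < L.
Notation G := (long_bipartite n L).
Notation vtx := (vtx n L).

(* Colours: [i < n] for the vertices next to [apex i], [n] for the vertices that
   get no further neighbours, [n.+1] and [n.+2] for the vertices to be joined. *)
Let leg_colour T (v : vtx) : nat :=
  if v.2 is Some (_, t) then
    if t == 0 :> nat then (v.1 : nat) else if t < T then n else if t == T :> nat then n.+1 else n.+2
  else n.

Let leg i j T : {set vtx} := [set v : vtx |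
  (v.1 == i) && (if v.2 is Some (j', t) then (j' == j) && (t <= T) else false)].

(** The clique of leg ends has colour [n.+2], which leaves [n.+1] for the end of the next leg. *)
Let star_colour (v : vtx) : nat :=
  if v.2 is Some (_, t) then
    if t == 0 :> nat then (v.1 : nat) else if t < L then n else n.+2
  else n.

Let legs i j : {set vtx} := [set v : vtx |
  (v.1 < i) && (if v.2 is Some (j', t) then j' == j else false)].

Let final_colour (v : vtx) : nat :=
  if v.2 is Some (_, t) then if t == 0 :> nat then (v.1 : nat) else n else n.

Let stars j : {set vtx} := [set v : vtx |
  if v.2 is Some (j', t) then j' < j else false].

Let apices i : {set vtx} := [set v : vtx |
  if v.2 is Some _ then true else v.1 < i].

Let vtx_eqE i j t i' j' t' :
  ((i, Some (j, t)) == (i', Some (j', t')) :> vtx) =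
  [&& i == i', j == j' & t == t' :> nat].
Proof. by []. Qed.

Let vtx_eqNE i i' p : ((i, None) == (i', Some p) :> vtx) = false.
Proof. by rewrite xpair_eqE andbF. Qed.

Let vtxE := (vtx_eqE, vtx_eqNE).

Lemma cw_leg i j T : 0 < T -> T <= L -> cw_on n.+2 G (leg i j T) (leg_colour T).
Proof.
elim: T => // T IHT _ TL.
have ineq := ltn_ord i.
pose v : vtx := (i, Some (j, inord T.+1)).
have vT : (inord T.+1 : 'I_L.+1) = T.+1 :> nat by rewrite inordK.
have -> : leg i j T.+1 = leg i j T :|: [set v].
  apply/setP=> -[i' [[j' t]|]]; rewrite !inE /v ?vtxE /= ?vT ?andbF //.
  by case: (i' == i); case: (j' == j) => //=; rewrite leq_eqVlt ltnS orbC.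
have dis : [disjoint leg i j T & [set v]].
  by rewrite disjoint_sym disjoints1 inE /= vT ltnn !andbF.
have [T0|T_gt0] := posnP T.
  subst T; apply: (@cw_on_join _ _ _ _ _ _ i n.+1) => //; try lia.
  - move=> [i' [[j' t]|]]; rewrite !inE /= ?andbF // => /and3P[_ _].
    rewrite leqn0 /leg_colour /= => ->; have := ltn_ord i'; lia.
  - by move=> x /set1P->; rewrite /leg_colour /= vT /=; lia.
  - move=> [i' [[j' t]|]] y; rewrite !inE /= ?andbF // => /and3P[/eqP-> /eqP-> t0] /eqP->.
    rewrite /leg_rel /leg_colour /= vT !eqxx /=.
    by move: t0; rewrite leqn0 => /eqP->; rewrite !eqxx.
  - have -> : leg i j 0 = [set (i, Some (j, ord0))].
      by apply/setP=> -[i' [[j' t]|]]; rewrite !inE ?vtxE /= ?leqn0 ?andbF.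
    apply: cw_on1; rewrite /leg_colour /=; lia.
  - apply: cw_on1; rewrite /leg_colour /= vT /=; lia.
(* Under [leg_colour T] the old end has colour [n.+1] and the new vertex [n.+2]. After the join, the
   old end retires to [n] and the new one takes over [n.+1]. *)
have step : cw_on n.+2 G (leg i j T :|: [set v]) (leg_colour T).
  apply: (@cw_on_join _ _ _ _ _ _ n.+1 n.+2) => //; try lia.
  - move=> [i' [[j' t]|]]; rewrite !inE /= ?andbF // => /and3P[_ _ tT].
    rewrite /leg_colour /=; have := ltn_ord i'; do ?case: ifP; lia.
  - by move=> x /set1P->; rewrite /leg_colour /= vT; do ?case: ifP; lia.
  - move=> [i' [[j' t]|]] y; rewrite !inE /= ?andbF // => /and3P[/eqP-> /eqP-> tT] /eqP->.
    rewrite /leg_rel /leg_colour /= vT !eqxx /=; do ?case: ifP; lia.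
  - exact/IHT/ltnW.
  - apply: cw_on1; rewrite /leg_colour /= vT; do ?case: ifP; lia.
have step2 := cw_on_recolour (i := n.+2) (j := n.+1) (leqnn _) (leqnSn _)
  (cw_on_recolour (i := n.+1) (j := n) (leqnSn _) (ltnW (leqnSn _)) step).
apply: (cw_on_eq step2) => // -[i' [[j' t]|]]; rewrite !inE ?vtxE /= ?andbF //.
rewrite vT => ht.
rewrite /leg_colour /=; have := ltn_ord i'; do ?case: ifP; lia.
Qed.

Lemma cw_star i j : i <= n -> cw_on n.+2 G (legs i j) star_colour.
Proof.
elim: i => [|i IHi] ltin.
  have -> : legs 0 j = set0 by apply/setP=> v; rewrite !inE ltn0.
  exact: cw_on0.
pose o := Ordinal ltin.
have -> : legs i.+1 j = legs i j :|: leg o j L.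
  apply/setP=> -[i' [[j' t]|]]; rewrite !inE /= ?andbF //.
  by rewrite -[i' == o]val_eqE /= leq_ord andbT -andb_orl ltnS leq_eqVlt orbC.
pose c (v : vtx) := if v.1 == o then leg_colour L v else star_colour v.
have inlegs i' j' t : ((i', Some (j', t)) \in legs i j) -> (i' == o) = false.
  by rewrite inE /= => /andP[+ _]; rewrite -val_eqE /=; lia.
(* This join attaches the end of the new leg to all earlier ends, after which it takes their colour
   [n.+2]. *)
have step : cw_on n.+2 G (legs i j :|: leg o j L) c.
  apply: (@cw_on_join _ _ _ _ _ _ n.+2 n.+1) => //.
  - lia.
  - rewrite disjoint_sym disjoints_subset; apply/subsetP=> -[i' [[j' t]|]].
      by rewrite !inE /= -val_eqE /=; lia.
    by rewrite !inE /= andbF.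
  - move=> [i' [[j' t]|]] xl; last by move: xl; rewrite !inE andbF.
    rewrite /c /= (inlegs _ _ _ xl) /star_colour /=; have := ltn_ord i'; do ?case: ifP; lia.
  - move=> [i' [[j' t]|]]; rewrite !inE /= ?andbF // => /and3P[i'o _ tL].
    rewrite /c /= i'o /leg_colour /=; have := ltn_ord i'; do ?case: ifP; lia.
  - move=> [i' [[j' t]|]] [i2 [[j2 t2]|]] xl; rewrite !inE /= ?andbF //; last first.
      by move: xl; rewrite !inE andbF.
    move=> /and3P[/eqP-> /eqP-> t2L].
    have i'o := inlegs _ _ _ xl; move: xl; rewrite inE /= => /andP[_ /eqP->].
    rewrite /c /leg_rel /= i'o !eqxx /= /star_colour /leg_colour /=.
    have := ltn_ord t; have := ltn_ord i'; have := ltn_ord i2; do ?case: ifP; lia.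
  - apply: cw_on_eq (IHi (ltnW ltin)) _ _ => // -[i' [[j' t]|]] xl.
      by rewrite /c /= (inlegs _ _ _ xl).
    by move: xl; rewrite !inE andbF.
  - apply: cw_on_eq (cw_leg o j L0 (leqnn L)) _ _ => // -[i' [[j' t]|]].
      by rewrite !inE /c /= => /andP[->].
    by rewrite !inE andbF.
apply: (cw_on_eq (cw_on_recolour (i := n.+1) (j := n.+2) (leqnSn _) (leqnn _) step)) => //.
move=> [i' [[j' t]|]] _; rewrite /c /star_colour /leg_colour /=.
  have := ltn_ord t; have := ltn_ord i'; do ?case: ifP; lia.
by do ?case: ifP; lia.
Qed.

(** Different stars are not adjacent; the centre of a finished star retires to colour [n]. *)
Lemma cw_stars j : j <= n.+1 -> cw_on n.+2 G (stars j) final_colour.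
Proof.
elim: j => [|j IHj] ltj.
  have -> : stars 0 = set0 by apply/setP=> -[i [[j' t]|]]; rewrite !inE.
  exact: cw_on0.
pose o := Ordinal ltj.
have -> : stars j.+1 = stars j :|: legs n o.
  apply/setP=> -[i' [[j' t]|]]; rewrite !inE /= ?andbF //.
  by rewrite ltn_ord -val_eqE /= ltnS leq_eqVlt orbC.
apply: cw_on_union.
- rewrite disjoint_sym disjoints_subset; apply/subsetP=> -[i' [[j' t]|]].
    by rewrite !inE /= -val_eqE /=; lia.
  by rewrite !inE andbF.
- move=> [i1 [[j1 t1]|]] [i2 [[j2 t2]|]]; rewrite !inE /= ?andbF //.
  move=> lt1 /andP[_ /eqP->]; rewrite /leg_rel /=.
  by case: eqP => // Ej; move: lt1; rewrite Ej /= ltnn.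
- exact/IHj/ltnW.
- have := cw_on_recolour (i := n.+2) (j := n) (leqnn _) (ltnW (leqnSn _)) (cw_star o (leqnn n)).
  move/cw_on_eq; apply=> // -[i' [[j' t]|]] _; rewrite /star_colour /final_colour /=.
    have := ltn_ord t; have := ltn_ord i'; do ?case: ifP; lia.
  by do ?case: ifP; lia.
Qed.

(** Colour [i] now occurs exactly on the neighbours of [apex i], so the apex enters with colour
    [n.+1], is joined to colour [i] and retires to [n]. *)
Lemma cw_apices i : i <= n -> cw_on n.+2 G (apices i) final_colour.
Proof.
elim: i => [|i IHi] ltin.
  have -> : apices 0 = stars n.+1.
    by apply/setP=> -[i [[j' t]|]]; rewrite !inE /= ?ltn_ord.
  exact: cw_stars.
pose o := Ordinal ltin.
have -> : apices i.+1 = apices i :|: [set apex L o].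
  apply/setP=> -[i' [[j' t]|]]; rewrite !inE xpair_eqE //= andbT -val_eqE /=.
  by rewrite ltnS leq_eqVlt orbC.
pose c (v : vtx) := if v == apex L o then n.+1 else final_colour v.
have notin v : v \in apices i -> (v == apex L o) = false.
  by move=> va; apply: contraTF va => /eqP->; rewrite !inE /= ltnn.
have step : cw_on n.+2 G (apices i :|: [set apex L o]) c.
  apply: (@cw_on_join _ _ _ _ _ _ i n.+1) => //; try lia.
  - by rewrite disjoint_sym disjoints1 inE /= ltnn.
  - move=> v va; rewrite /c notin //; case: v {va} => i' [[j' t]|];
      rewrite /final_colour /=; have := ltn_ord i'; do ?case: ifP; lia.
  - by move=> v /set1P->; rewrite /c eqxx; lia.
  - move=> v w va /set1P->; rewrite /c notin // !eqxx andbT.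
    case: v {va} => i' [[j' t]|]; rewrite /= /leg_rel /final_colour /=; last lia.
    rewrite -val_eqE /=; have := ltn_ord i'; do ?case: ifP; lia.
  - by apply: cw_on_eq (IHi (ltnW ltin)) _ _ => // v va; rewrite /c notin.
  - by apply: cw_on1; rewrite /c eqxx.
apply: (cw_on_eq (cw_on_recolour (i := n.+1) (j := n) (leqnSn _) (ltnW (leqnSn _)) step)) => //.
move=> v _; rewrite /c; case: (eqVneq v (apex L o)) => [->|_]; first by rewrite eqxx.
case: v => i' [[j' t]|]; rewrite /final_colour /=; have := ltn_ord i'; do ?case: ifP; lia.
Qed.

Lemma cliquewidth_long_bipartite : cliquewidth G <= n.+3.
Proof.
rewrite /cliquewidth; case: ex_minnP => m _; apply; apply/asboolP.
exists (fun v => inord (final_colour v)); apply: cw_on_setT.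
suff <- : apices n = setT by apply: cw_apices.
by apply/setP=> -[i [[j t]|]]; rewrite !inE //= ltn_ord.
Qed.
End LongBipartiteCw.

(** * Choice of the leg length and comparison with the treewidth *)

Local Open Scope ring_scope.

Theorem theorem2 (R : realType) (c : R) (k : nat) (hc : 1 <= c)
    (hk : (6 <= k)%N) :
  exists (V : finType) (G : sgraph V),
    (cliquewidth G <= k)%N /\
    forall (W : finType) (H : sgraph W),
      treewidth H < k%:Z - 3 -> ~ quasi_isometric c G H.
Proof.
have [n n0 kE] : exists2 n, (0 < n)%N & k = n.+3 by exists (k - 3)%N; lia.
subst k; have := archi_boundP (le_trans ler01 hc).
move: (Num.bound c) => C /ltW cC.
(* This is [C * (2 * R + C)] written out; the successor makes [L] positive. *)
pose L := (C * (2 * (2 * C + (C * (C * (2 * (2 * C) + C)) + C)) + C)).+1%N.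
exists (vtx n L), (long_bipartite n L); split.
  exact: cliquewidth_long_bipartite.
move=> W H; rewrite /treewidth; case: ex_minnP => m /asboolP.
case=> [N [T [bag [dec bagE]]]] _ ltm [f qi].
have [t] : exists t, (n < #|bag t|)%N.
  apply: (coarse_minor_bag n0 (qi_reach hc cC qi) (qi_reach_inv hc cC qi)) dec.
  exact: leqnSn.
(* The bound on the treewidth reads [m - 1 < n], so a bag with more than [n] vertices is too
   large. *)
have : (#|bag t| <= m)%N by rewrite -bagE; apply: (leq_bigmax t).
by move: ltm; lia.
Qed.
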